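(* Let $\kappa$ be a regular cardinal. If $A\subset\mathbb N^*$ is a simple almost clopen set of type $\kappa$, then $\kappa\in\{\mathfrak b,\mathfrak d\}$.
   Context: $\mathbb N^*=\beta\mathbb N\setminus\mathbb N$ is the space of free ultrafilters on $\mathbb N$; for $a\subset\mathbb N$, $a^*$ is the basic clopen set of all free ultrafilters containing $a$. For subsets of $\mathbb N$, $a\subset^* b$ means $a\setminus b$ is finite. A set $A\subset\mathbb N^*$ is almost clopen if $A$ is the closure of an open subset of $\mathbb N^*$ and has a unique boundary point, which is denoted $x_A$. For $A\subset\mathbb N^*$, $\mathcal I_A=\{a\subset\mathbb N: a^*\subset A\}$. For a regular cardinal $\kappa$, an almost clopen set $A$ is simple of type $\kappa$ if $\mathcal I_A$ has a $\subset^*$-cofinal $\subset^*$-increasing chain $\{a_\alpha:\alpha\in\kappa\}$ of type $\kappa$. $\mathfrak b$ and $\mathfrak d$ are the usual bounding and dominating numbers, i.e. the least cardinality of an unbounded, respectively dominating, family in $\mathbb N^{\mathbb N}$ with respect to the ordering $f<^*g$ iff $\{k: g(k)\le f(k)\}$ is finite. *)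

(* Defs.v *)
From HB Require Import structures.
From mathcomp Require Import all_boot all_order.
From mathcomp Require Import all_classical wochoice.
From mathcomp Require Import topology.

Set Implicit Arguments.
Unset Strict Implicit.
Unset Printing Implicit Defensive.

Local Open Scope classical_set_scope.
Local Open Scope card_scope.

Definition free_filter (T : Type) (U : set_system T) : Prop :=
  \bigcap_(a in U) a = set0.

(* N^*, with the topology having the sets star a = a^* as a base. *)
Record Nstar : Type := MkNstar {
  nstar_sets : set_system nat ;
  nstar_ultra : UltraFilter nstar_sets ;
  nstar_free : free_filter nstar_sets }.

#[global] Existing Instance nstar_ultra.

HB.instance Definition _ := gen_eqMixin Nstar.
HB.instance Definition _ := gen_choiceMixin Nstar.

Definition star (a : set nat) : set Nstar := [set U : Nstar | nstar_sets U a].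

Lemma star_cover : \bigcup_(a in [set: set nat]) star a = setT.
Proof.
apply/seteqP; split=> // U _; exists setT => //.
exact: filterT.
Qed.

Lemma star_join (a b : set nat) (U : Nstar) :
  [set: set nat] a -> [set: set nat] b -> star a U -> star b U ->
  exists c, [/\ [set: set nat] c, star c U & star c `<=` star a `&` star b].
Proof.
move=> _ _ Ua Ub; exists (a `&` b); split=> //.
  exact: filterI.
by move=> V Vab; split; apply: filterS Vab => n [].
Qed.

HB.instance Definition _ :=
  isBaseTopological.Build Nstar star_cover star_join.

Lemma open_star (a : set nat) : open (star a).
Proof. by exists [set a] => //; rewrite bigcup_set1. Qed.

Lemma star_setC (a : set nat) : star (~` a) = ~` star a.
Proof.
apply/seteqP; split=> U; rewrite /star /=.
  move=> Uca Ua; apply: (@filter_not_empty _ (nstar_sets U)).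
  by rewrite -(setICr a); exact: filterI.
by have [//|] := in_ultra_setVsetC a (nstar_ultra U).
Qed.

Lemma clopen_star (a : set nat) : clopen (star a).
Proof.
split; first exact: open_star.
by rewrite -[star a]setCK -star_setC; apply: open_closedC; exact: open_star.
Qed.

Definition boundary (T : topologicalType) (A : set T) : set T :=
  closure A `\` A°.

Definition almost_clopen (A : set Nstar) : Prop :=
  (exists2 O : set Nstar, open O & A = closure O) /\
  (exists x : Nstar, boundary A = [set x]).

Definition almost_subset (a b : set nat) : Prop := finite_set (a `\` b).

Definition ideal_of (A : set Nstar) : set (set nat) :=
  [set a | star a `<=` A].

(* A cardinal is represented by a well-ordered type that is an initial ordinal:
   no proper initial segment has the cardinality of the whole type. Regularity
   (infinite, and equal to its cofinality) says that every cofinal subset has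
   the cardinality of the whole type. *)
Definition regular_cardinal (d : Order.disp_t) (K : orderType d) : Prop :=
  [/\ infinite_set [set: K],
      well_order (<=%O : rel K),
      (forall x : K, ~ ([set: K] #<= [set y : K | (y < x)%O])) &
      (forall S : set K, (forall x, exists2 y, S y & (x <= y)%O) ->
        [set: K] #<= S)].

Definition simple_of_type (d : Order.disp_t) (K : orderType d)
    (A : set Nstar) : Prop :=
  almost_clopen A /\
  exists a : K -> set nat,
    [/\ (forall i, ideal_of A (a i)),
        (forall i j : K, (i < j)%O -> almost_subset (a i) (a j)) &
        (forall b, ideal_of A b -> exists i, almost_subset b (a i))].

Definition lt_star (f g : nat -> nat) : Prop :=
  finite_set [set k | (g k <= f k)%N].

Definition unbounded_family (B : set (nat -> nat)) : Prop :=
  ~ exists g, forall f, B f -> lt_star f g.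

Definition dominating_family (D : set (nat -> nat)) : Prop :=
  forall f, exists2 g, D g & lt_star f g.

Definition least_cardinality (T K : Type) (P : set T -> Prop) : Prop :=
  (exists2 B : set T, P B & B #= [set: K]) /\
  (forall B : set T, P B -> [set: K] #<= B).

(* For a type K carrying a cardinal kappa these say kappa = b and kappa = d. *)
Definition is_bounding_number (K : Type) : Prop :=
  least_cardinality K unbounded_family.

Definition is_dominating_number (K : Type) : Prop :=
  least_cardinality K dominating_family.

(* Main.v *)
Require Import Defs.
From mathcomp Require Import all_boot all_order.
From mathcomp Require Import all_classical wochoice.
From mathcomp Require Import topology zify.

Set Implicit Arguments.
Unset Strict Implicit.
Unset Printing Implicit Defensive.

Import Order.TTheory.

Local Open Scope classical_set_scope.
Local Open Scope card_scope.

(** Why the theorem holds.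

    Let [a i] be the chain and [x] the boundary point.  If a set [b] is not in
    [x], then [b^*] meets [A] only in interior points, so by compactness
    [b^* /\ A] lies in a single [(a i)^*]; hence from [i] on all differences
    [a k \ a j] are almost disjoint from [b].  Since one of [b] and its
    complement is outside [x], every set of integers either almost contains
    or is almost disjoint from all differences [a k \ a j] with [j] large
    ([cofinal_chain_decides]).  The chain has no last step, so each [j] has an
    infinite difference, which is recorded by a function [e j] sending [n] to
    one of its elements above [n].  The topology is then forgotten: all that
    is kept is that the functions [e j] are [ultraconvergent].

    (1) No function bounds cofinally many [e j]: if [h] did, every [e j] in
    question would have values in almost all intervals of a partition that
    grows faster than [h], and the union of every other interval would
    contradict ultraconvergence.  Hence the [e j] form an unbounded family, so
    that b <= kappa; and by regularity a dominating family, each member of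
    which bounds only boundedly many [e j], has at least kappa members, so
    that kappa <= d.

    (2) Suppose b < kappa and take an unbounded [B] of size less than kappa.
    Replacing functions by their running maxima, assume that [h] and the
    members of [B] are nondecreasing.  Given [h], ultraconvergence
    decides for each [g] in [B] the set where [h] is below [g], and by
    regularity one index serves all [g].  If every
    decision were negative, then [h o e i] would bound [B].  So some [g]
    exceeds [h] on the values of all late [e j], and by monotonicity
    [g o e j] dominates [h] ([ultraconvergent_ultrapower_cofinal]).  It
    remains to keep the size of this dominating family at kappa: instead of all
    pairs [(g, j)], pair each [j] with one label [phi j] in [B], every label
    being used cofinally often ([cofinal_labelling]).  So d <= kappa, and
    kappa = d by (1). *)

(** * Almost inclusion and basic clopen sets *)

Lemma finite_set_near (a : set nat) :
  finite_set a <-> \forall n \near \oo, ~ a n.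
Proof.
split=> [/finite_seqP[s ->]|[N _ aN]].
  exists (\max_(i <- s) i).+1 => // n /= ltn ns.
  have := @leq_bigmax_seq _ s xpredT (fun i => i) n ns isT.
  by rewrite leqNgt ltn.
apply: (@sub_finite_set _ _ `I_N) (finite_II N) => n an.
by rewrite /= ltnNge; apply/negP => /aN.
Qed.

Lemma almost_subsetP (a b : set nat) :
  almost_subset a b <-> \forall n \near \oo, a n -> b n.
Proof.
rewrite /almost_subset finite_set_near; split; apply: filterS => n /=.
  by move=> nab an; apply: contrapT => nbn; apply: nab.
by move=> ab [/ab].
Qed.

Lemma lt_starP (f g : nat -> nat) :
  lt_star f g <-> \forall n \near \oo, f n < g n.
Proof.
by rewrite /lt_star finite_set_near; split; apply: filterS => n /=;
  rewrite ltnNge => /negP.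
Qed.

Lemma almost_subset_refl (a : set nat) : almost_subset a a.
Proof. by rewrite /almost_subset setDv; exact: finite_set0. Qed.

Lemma almost_subset_trans (b a c : set nat) :
  almost_subset a b -> almost_subset b c -> almost_subset a c.
Proof.
rewrite !almost_subsetP; apply: filterS2 => n ab bc /ab; exact: bc.
Qed.

(** An ultrafilter is free as soon as it contains the cofinite sets. *)
Lemma filter_Nstar (F : set_system nat) : ProperFilter F ->
  \oo `<=` F -> exists U : Nstar, F `<=` nstar_sets U.
Proof.
move=> FF ooF; have [G [UG FG]] := ultraFilterLemma FF.
suff Gfree : free_filter G by exists (MkNstar UG Gfree).
apply/seteqP; split=> // n Gn.
have /Gn /= : G [set m | n < m] by apply/FG/ooF; exact: nbhs_infty_gt.
by rewrite ltnn.
Qed.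

Lemma star_subset (a b : set nat) :
  star a `<=` star b -> almost_subset a b.
Proof.
move=> sab; apply: contrapT => nab.
have FF : ProperFilter (within (a `\` b) \oo).
  apply: Build_ProperFilter => near0; apply: nab.
  by rewrite /almost_subset finite_set_near.
have [U FU] := filter_Nstar FF (@cvg_within _ _ _ _).
have Uab : nstar_sets U (a `\` b).
  by apply: FU; rewrite /within/=; exact: filterE.
have Ub : star b U by apply: sab; apply: filterS Uab => n [].
have : star (~` b) U by apply: filterS Uab => n [].
by rewrite star_setC.
Qed.

Lemma almost_subset_star (a b : set nat) :
  almost_subset a b -> star a `<=` star b.
Proof.
move=> /almost_subsetP[N _ ab] U Ua.
have UN m : nstar_sets U [set n | m <= n].
  elim: m => [|m Um]; first by apply: filterS (filterT : nstar_sets U setT).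
  (* freeness provides a set of [U] that omits [m] *)
  have [[c Uc ncm]|nc] := pselect (exists2 c, nstar_sets U c & ~ c m).
    apply: filterS (filterI Um Uc) => n [/= mn cn].
    by rewrite ltn_neqAle mn andbT; apply/eqP => mE; apply: ncm; rewrite mE.
  suff : (\bigcap_(c in nstar_sets U) c) m by rewrite (nstar_free U).
  by move=> c Uc; apply: contrapT => ncm; apply: nc; exists c.
by apply: filterS (filterI Ua (UN N)) => n [an /ab]; exact.
Qed.

(** * The chain of an almost clopen set *)

Definition cofinal_chain (d : Order.disp_t) (K : orderType d) (A : set Nstar)
    (a : K -> set nat) : Prop :=
  [/\ (forall i, ideal_of A (a i)),
      (forall i j : K, (i < j)%O -> almost_subset (a i) (a j)) &
      (forall b, ideal_of A b -> exists i, almost_subset b (a i))].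

Lemma almost_clopen_closed (A : set Nstar) : almost_clopen A -> closed A.
Proof. by move=> [[O _ ->] _]; exact: closed_closure. Qed.

Lemma boundary_almost_clopen (A : set Nstar) : almost_clopen A ->
  boundary A = A `\` interior A.
Proof.
by move=> /almost_clopen_closed/closure_id AE; rewrite /boundary -AE.
Qed.

Lemma open_sub_star (O : set Nstar) U : open O -> O U ->
  exists2 c, star c U & star c `<=` O.
Proof.
move=> [D _ <-] [c Dc cU]; exists c => // V cV; by exists c.
Qed.

Lemma cofinal_chain_le (d : Order.disp_t) (K : orderType d) A (a : K -> set nat)
  (i j : K) : cofinal_chain A a -> (i <= j)%O -> almost_subset (a i) (a j).
Proof.
move=> [_ a_lt _]; rewrite le_eqVlt => /predU1P[->|/a_lt//].
exact: almost_subset_refl.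
Qed.

(** If the chain had an almost largest member [a i], then [A] would be the
    clopen set [star (a i)], which has no boundary point. *)
Lemma cofinal_chain_unbounded (d : Order.disp_t) (K : orderType d) A
    (a : K -> set nat) (i : K) :
  almost_clopen A -> cofinal_chain A a -> exists j, ~ almost_subset (a j) (a i).
Proof.
move=> Aac [aA _ a_cof]; apply: contrapT => /forallNP noj.
have aji j : almost_subset (a j) (a i) by exact: contrapT (noj j).
have AE : A = star (a i).
  apply/seteqP; split; last exact: aA.
  have [[O oO AO] _] := Aac.
  rewrite {1}AO.
  have /closure_id -> : closed (star (a i)) by case: (clopen_star (a i)).
  apply: closureS => U OU; have [c cU cO] := open_sub_star oO OU.
  have [j cj] : exists j, almost_subset c (a j).
    by apply: a_cof => V cV; rewrite AO; apply/subset_closure/cO.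
  exact: almost_subset_star (almost_subset_trans cj (aji j)) _ cU.
have [_ [x]] := Aac; rewrite boundary_almost_clopen//.
have /interior_id -> : open A by rewrite AE; exact: open_star.
by rewrite setDv => /seteqP[_ /(_ x erefl)].
Qed.

(** This is compactness of [star b `&` A], a closed set covered by the
    increasing open sets [star (a i)].  A filter witnessing the failure of the
    conclusion extends to a point of [star b `&` A] outside every [star (a i)];
    such a point cannot be interior to [A], so it is a boundary point. *)
Lemma cofinal_chain_absorbs (d : Order.disp_t) (K : orderType d) A
    (a : K -> set nat) (b : set nat) :
  almost_clopen A -> cofinal_chain A a -> star b `&` boundary A = set0 ->
  exists i, star b `&` A `<=` star (a i).
Proof.
move=> Aac achain bA0; have [_ _ a_cof] := achain.
apply: contrapT => /forallNP noi.
(* the filter of all [c] such that [star c] contains some closed set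
   [(star b `&` A) `\` star (a i)] *)
pose F : set_system nat :=
  [set c | exists i, (star b `&` A) `\` star (a i) `<=` star c].
have [i0 _] : exists i, almost_subset set0 (a i).
  by apply: a_cof => U U0; case: (@filter_not_empty _ (nstar_sets U) _ U0).
have FF : ProperFilter F.
  split.
    move=> [i sub0]; apply: (noi i) => U bAU; apply: contrapT => naU.
    exact: filter_not_empty (sub0 U (conj bAU naU)).
  split.
  - exists i0 => U _; exact: filterT.
  - move=> p q [i ip] [j jq]; exists (Order.max i j) => U [bAU naU].
    by apply: filterI; [apply: ip|apply: jq]; split=> // aU; apply: naU;
      apply: almost_subset_star aU; apply: (cofinal_chain_le achain);
      rewrite le_max lexx ?orbT.
  - move=> p q pq [i ip]; exists i => U /ip; apply: filterS; exact: pq.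
have [c [N _ cN]|U FU] := filter_Nstar FF.
  exists i0 => U _.
  apply: (@almost_subset_star setT) (filterT : star setT U).
  by apply/almost_subsetP; exists N => // n /cN.
have bU : star b U by apply: FU; exists i0 => V [[]].
have AU : A U.
  apply: contrapT => nAU.
  have [c cU cA] := open_sub_star (closed_openC (almost_clopen_closed Aac)) nAU.
  suff : star (~` c) U by rewrite star_setC.
  by apply: FU; exists i0 => V [[_ AV] _]; rewrite star_setC => /cA.
have [c cU cA] : exists2 c, star c U & star c `<=` interior A.
  apply: open_sub_star; first exact: open_interior.
  apply: contrapT => nAU; suff : (star b `&` boundary A) U by rewrite bA0.
  by rewrite boundary_almost_clopen.
have [i ci] : exists i, almost_subset c (a i).
  by apply: a_cof => V /cA/interior_subset.
have aiU := almost_subset_star ci cU.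
suff : star (~` a i) U by rewrite star_setC.
by apply: FU; exists i => V [_]; rewrite star_setC.
Qed.

(** The differences [a k `\` a j] converge to the boundary point as [j] grows:
    of the two sets [star b] and [star (~` b)], one misses that point and is
    therefore absorbed by the chain. *)
Lemma cofinal_chain_decides (d : Order.disp_t) (K : orderType d) A
    (a : K -> set nat) (b : set nat) :
  almost_clopen A -> cofinal_chain A a ->
  (exists i, forall j k, (i <= j)%O -> almost_subset (a k `\` a j) b) \/
  (exists i, forall j k, (i <= j)%O -> almost_subset (a k `\` a j) (~` b)).
Proof.
move=> Aac achain.
have key c : star c `&` boundary A = set0 ->
  exists i, forall j k, (i <= j)%O -> almost_subset (a k `\` a j) (~` c).
  move=> /(cofinal_chain_absorbs Aac achain)[i ci]; exists i => j k ij.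
  have [aA _ _] := achain.
  have : almost_subset (c `&` a k) (a j).
    apply: almost_subset_trans (cofinal_chain_le achain ij).
    apply: star_subset => U cakU; apply: ci; split.
      by apply: filterS cakU => n [].
    by apply: (aA k); apply: filterS cakU => n [].
  rewrite !almost_subsetP; apply: filterS => n caj [akn najn] cn.
  exact/najn/caj.
have [_ [x Ax]] := Aac; have [bx|nbx] := pselect (star b x).
  left; rewrite -[b]setCK; apply: key; rewrite star_setC Ax.
  by apply/seteqP; split=> // y [/= nby yx]; apply: nby; rewrite yx.
right; apply: key; rewrite Ax.
by apply/seteqP; split=> // y [/= nby yx]; apply: nbx; rewrite -yx.
Qed.

(** * Ultraconvergent families of functions *)

(** The values of the [e j] converge to an ultrafilter as [j] grows: the sets
    [b] for which the first alternative holds are its members. *)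
Definition ultraconvergent (d : Order.disp_t) (K : orderType d)
    (e : K -> nat -> nat) : Prop :=
  forall b : set nat,
    (exists i, forall j, (i <= j)%O -> \forall n \near \oo, b (e j n)) \/
    (exists i, forall j, (i <= j)%O -> \forall n \near \oo, ~ b (e j n)).

Lemma infinite_selector (c : set nat) : infinite_set c ->
  exists e : nat -> nat, forall n, n <= e n /\ c (e n).
Proof.
move=> cinf; suff /choice[e eP] : forall n, exists m, n <= m /\ c m by exists e.
move=> n; apply: contrapT => /forallNP nom; apply: cinf.
apply: (@sub_finite_set _ _ `I_n) (finite_II n) => m cm.
by rewrite /= ltnNge; apply/negP => nm; apply: (nom m).
Qed.

Lemma simple_ultraconvergent (d : Order.disp_t) (K : orderType d) A :
  simple_of_type K A ->
  exists2 e : K -> nat -> nat, ultraconvergent e & forall i n, n <= e i n.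
Proof.
move=> [Aac [a achain]].
have /choice[s sP] i := cofinal_chain_unbounded i Aac achain.
have /choice[e eP] i := infinite_selector (sP i).
exists e => [b|i n]; last by have [] := eP i n.
have aux c j : almost_subset (a (s j) `\` a j) c ->
    \forall n \near \oo, c (e j n).
  move=> /almost_subsetP[N _ sub]; exists N => // n /= Nn.
  have [ne se] := eP j n; apply: sub => //=; exact: leq_trans ne.
by have [[i H]|[i H]] := cofinal_chain_decides b Aac achain; [left|right];
  exists i => j ij; [apply: (aux b)|apply: (aux (~` b))]; exact: H.
Qed.

(** An [e j] below [h] from some point on has a value in almost every interval
    [[p k, p k.+1)], since [p] grows faster than [h].  The union of the
    intervals of even index then neither almost contains nor almost misses the
    values of [e j]. *)
Lemma ultraconvergent_not_bounded (d : Order.disp_t) (K : orderType d)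
    (e : K -> nat -> nat) (h : nat -> nat) :
  ultraconvergent e -> (forall i n, n <= e i n) ->
  exists i, forall j, (i <= j)%O -> ~ lt_star (e j) h.
Proof.
move=> econv le_e.
pose p k := iter k (fun n => (maxn n (h n)).+1) 0.
have pS k : p k < p k.+1 by rewrite /p iterS ltnS leq_maxl.
have hp k : h (p k) < p k.+1 by rewrite /p iterS ltnS leq_maxr.
have p_le k l : k <= l -> p k <= p l.
  by move=> kl; apply: (homo_leq (leqnn) leq_trans) kl => m; exact: ltnW.
have p_ge k : k <= p k by elim: k => // k /leq_ltn_trans; exact.
pose b := [set n | exists k, p k.*2 <= n < p k.*2.+1].
have block j M k : (forall n, M <= n -> e j n < h n) -> M <= k ->
    p k <= e j (p k) < p k.+1.
  move=> eh Mk; rewrite le_e/= (ltn_trans (eh _ _))//.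
  exact: leq_trans (p_ge k).
have [[i H]|[i H]] := econv b; exists i => j ij /lt_starP[M _ eh];
    have [L _ bL] := H j ij; pose k := maxn M L.
  have /andP[lo hi] : p k.*2.+1 <= e j (p k.*2.+1) < p k.*2.+2.
    by apply: (block j M) => //; lia.
  have [|l /andP[lo' hi']] := bL (p k.*2.+1).
    by have /= := p_ge k.*2.+1; lia.
  have kl : k.*2.+1 < l.*2.+1.
    by rewrite ltnNge; apply/negP => /p_le; lia.
  have lk : l.*2 < k.*2.+2.
    by rewrite ltnNge; apply/negP => /p_le; lia.
  lia.
apply: (bL (p k.*2)); first by have /= := p_ge k.*2; lia.
by exists k; apply: (block j M) => //; lia.
Qed.

(** * Sets of size less than the regular index *)

Lemma well_order_wf (d : Order.disp_t) (K : orderType d) :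
  well_order (<=%O : rel K) -> well_founded (fun i j : K => (i < j)%O).
Proof.
move=> wo i; apply: contrapT => nacc.
have [|j [[/asboolP naccj jmin] _]] :=
    wo [pred j | `[< ~ Acc (fun i j => (i < j)%O) j >]].
  by exists i; apply/asboolP.
apply: naccj; constructor => k kj; apply: contrapT => nacck.
by have := jmin k (asboolT nacck); rewrite leNgt kj.
Qed.

(** Otherwise the image of [B] is cofinal, and regularity makes it as large as
    [K]. *)
Lemma small_image_bounded (d : Order.disp_t) (K : orderType d) (T : Type)
    (B : set T) (f : T -> K) :
  regular_cardinal K -> ~ ([set: K] #<= B) ->
  exists i, forall t, B t -> (f t < i)%O.
Proof.
move=> [_ _ _ reg] smallB; apply: contrapT => /forallNP unbounded.
apply: smallB.
apply: card_le_trans (card_image_le f B); apply: reg => i.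
have /existsNP[t /not_implyP[Bt nlt]] := unbounded i.
by exists (f t); [exists t|rewrite leNgt; exact/negP].
Qed.

(** The labelling [phi] gives each index, by recursion, the label that has been
    idle for longest.  A label idle since some [i] would force every later
    choice to be idle since [i] as well, so [phi] would be injective from [i]
    on and [B] would not be small.  This takes the place of the cardinal
    equality [#|B| * kappa = kappa]. *)
Lemma cofinal_labelling (d : Order.disp_t) (K : orderType d) (T : Type)
    (B : set T) :
  regular_cardinal K -> B !=set0 -> ~ ([set: K] #<= B) ->
  exists2 phi : K -> T, (forall i, B (phi i)) &
    forall t, B t -> forall i, exists2 j, (i <= j)%O & phi j = t.
Proof.
move=> Kreg [t0 Bt0] smallB; have [_ wo _ _] := Kreg.
(* [unused i rec c t]: label [t] does not occur in the interval [[c, i)] *)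
pose unused (i : K) (rec : forall j, (j < i)%O -> T) (c : K) (t : T) :=
  forall j (ji : (j < i)%O), (c <= j)%O -> rec j ji <> t.
pose oldest (i : K) (rec : forall j, (j < i)%O -> T) (t : T) :=
  B t /\ exists2 c, unused i rec c t &
  forall c' t', B t' -> unused i rec c' t' -> (c <= c')%O.
have oldest_ex i rec : exists t, oldest i rec t.
  have [|c [[/asboolP[t Bt ct] cmin] _]] :=
      wo [pred c | `[< exists2 t, B t & unused i rec c t >]].
    exists i; apply/asboolP; exists t0 => // j ji ij.
    by have := le_lt_trans ij ji; rewrite ltxx.
  exists t; split=> //; exists c => // c' t' Bt' ct'.
  by apply: cmin; apply/asboolP; exists t'.
pose F i rec := projT1 (cid (oldest_ex i rec)).
pose phi := Fix (well_order_wf wo) (fun=> T) F.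
have phiE i : oldest i (fun j _ => phi j) (phi i).
  rewrite {2}/phi Fix_eq; first exact: projT2 (cid (oldest_ex i _)).
  move=> k f g fg; congr (F k _).
  by apply: functional_extensionality_dep => j; apply: funext => jk.
exists phi => [i|t Bt i]; first by have [] := phiE i.
apply: contrapT => nused.
(* at stage [k] the label [t] has been idle since [i], so [phi k] has too *)
have inj j k : (i <= j)%O -> (j < k)%O -> phi j <> phi k.
  move=> ij jk; have [_ [c cun cmin]] := phiE k.
  apply: cun => //; apply: le_trans ij; apply: (cmin _ t) => // l lk il lt.
  by apply: nused; exists l.
have /choice[psi psiP] s : exists k, forall j, (i <= j)%O -> phi j = s -> j = k.
  have [[k ik ks]|nk] := pselect (exists2 k, (i <= k)%O & phi k = s).
    exists k => j ij js; have [jk|kj|] := ltgtP j k => //.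
      by case: (inj j k ij jk); rewrite ks.
    by case: (inj k j ik kj); rewrite ks.
  by exists i => j ij js; case: nk; exists j.
have [c psic] := small_image_bounded psi Kreg smallB.
have ik : (i <= Order.max i c)%O by rewrite le_max lexx.
have := psic _ (proj1 (phiE (Order.max i c))).
by rewrite -(psiP _ _ ik erefl) gt_max ltxx andbF.
Qed.

(** * Comparison with the bounding and dominating numbers *)

Lemma ultraconvergent_unbounded (d : Order.disp_t) (K : orderType d)
    (e : K -> nat -> nat) :
  ultraconvergent e -> (forall i n, n <= e i n) -> unbounded_family (range e).
Proof.
move=> econv le_e [h eh].
have [i H] := ultraconvergent_not_bounded h econv le_e.
by apply: (H i) => //; apply: eh; exists i.
Qed.

(** Each [h] in [D] bounds [e i] only for [i] below some index depending on [h];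
    a small [D] would leave a common bound for these indices. *)
Lemma ultraconvergent_le_dominating (d : Order.disp_t) (K : orderType d)
    (e : K -> nat -> nat) (D : set (nat -> nat)) :
  regular_cardinal K -> ultraconvergent e -> (forall i n, n <= e i n) ->
  dominating_family D -> [set: K] #<= D.
Proof.
move=> Kreg econv le_e Ddom; apply: contrapT => smallD.
have /choice[bnd bndP] h := ultraconvergent_not_bounded h econv le_e.
have [i Di] := small_image_bounded bnd Kreg smallD.
have [h Dh] := Ddom (e i).
by apply: bndP; exact/ltW/Di.
Qed.

Definition running_max (f : nat -> nat) (n : nat) : nat := \max_(i < n.+1) f i.

Lemma le_running_max f n m : n <= m -> f n <= running_max f m.
Proof.
rewrite -ltnS => nm.
exact: (leq_bigmax (F := fun i : 'I_m.+1 => f i) (Ordinal nm)).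
Qed.

(** A small unbounded family is cofinal in the ultrapower of the integers by the
    limit ultrafilter; the strict inequality between running maxima at
    [e j n >= n] transfers to [h n] on the left. *)
Lemma ultraconvergent_ultrapower_cofinal (d : Order.disp_t) (K : orderType d)
    (e : K -> nat -> nat) (B : set (nat -> nat)) (h : nat -> nat) :
  regular_cardinal K -> ultraconvergent e -> (forall i n, n <= e i n) ->
  unbounded_family B -> ~ ([set: K] #<= B) ->
  exists2 g, B g & exists i, forall j, (i <= j)%O ->
    lt_star h (running_max g \o e j).
Proof.
move=> Kreg econv le_e Bunb smallB; apply: contrapT => nog.
pose b g := [set n | running_max h n < running_max g n].
have /choice[s sP] g : exists i, B g ->
    forall j, (i <= j)%O -> \forall n \near \oo, ~ b g (e j n).
  have [[i ib]|[i inb]] := econv (b g); exists i => // Bg.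
  case: nog; exists g => //; exists i => j /ib gj; apply/lt_starP.
  apply: filterS gj => n; exact: leq_ltn_trans (le_running_max h (le_e j n)).
have [i si] := small_image_bounded s Kreg smallB.
apply: Bunb; exists (fun n => (running_max h (e i n)).+1) => g Bg.
apply/lt_starP; have := sP g Bg i (ltW (si g Bg)); apply: filterS => n /negP.
rewrite -leqNgt ltnS; exact/leq_trans/le_running_max.
Qed.

Lemma ultraconvergent_dominating (d : Order.disp_t) (K : orderType d)
    (e : K -> nat -> nat) (B : set (nat -> nat)) :
  regular_cardinal K -> ultraconvergent e -> (forall i n, n <= e i n) ->
  unbounded_family B -> ~ ([set: K] #<= B) ->
  exists2 D, dominating_family D & D #<= [set: K].
Proof.
move=> Kreg econv le_e Bunb smallB.
have B0 : B !=set0.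
  apply: contrapT => nB; apply: Bunb; exists id => f Bf.
  by case: nB; exists f.
have [phi phiB phi_cof] := cofinal_labelling Kreg B0 smallB.
exists (range (fun i => running_max (phi i) \o e i)); last exact: card_image_le.
move=> h.
have [g Bg [i ig]] :=
  ultraconvergent_ultrapower_cofinal h Kreg econv le_e Bunb smallB.
have [j ij jg] := phi_cof g Bg i.
by exists (running_max (phi j) \o e j); [exists j|rewrite jg; exact: ig].
Qed.

Theorem theorem2p5 (d : Order.disp_t) (K : orderType d) (A : set Nstar)
    (hK : regular_cardinal K) (hA : simple_of_type K A) :
  is_bounding_number K \/ is_dominating_number K.
Proof.
have [e econv le_e] := simple_ultraconvergent hA.
have [bmin|/existsNP[B /not_implyP[Bunb smallB]]] :=
    pselect (forall B, unbounded_family B -> [set: K] #<= B).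
  left; split=> //; have eunb := ultraconvergent_unbounded econv le_e.
  exists (range e) => //; rewrite card_eq_le card_image_le /=.
  exact: bmin.
right; have dmin D := @ultraconvergent_le_dominating _ _ _ D hK econv le_e.
split=> //.
have [D Ddom DK] := ultraconvergent_dominating hK econv le_e Bunb smallB.
by exists D => //; rewrite card_eq_le DK /=; exact: dmin.
Qed.
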